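(* Let $m,n,r$ be integers with $r\le m,n$ and let $G=([m],[n],E)$ be a bipartite graph such that $|E|=r(m+n-r)$. Then $\operatorname{gcr}(G)=r$ if there exist set partitions $P_1,\dots,P_{m-r}$ of $[m]$ and $Q_1,\dots,Q_{n-r}$ of $[n]$ such that each induced bipartite subgraph $G_{P_i,Q_j}$ on parts $P_i$ and $Q_j$ contains exactly one non-edge of $G$, and every non-edge of $G$ lies in some such $G_{P_i,Q_j}$.
   Context: $[m]=\{1,\dots,m\}$; $m,n\ge1$ and $r\ge0$. $G=([m],[n],E)$ denotes a bipartite graph with parts (disjoint copies of) $[m]$ and $[n]$ and edge set $E\subseteq[m]\times[n]$. A non-edge of $G$ is a pair in $([m]\times[n])\setminus E$. For $A\subseteq[m]$, $B\subseteq[n]$, $G_{A,B}$ is the induced subgraph of $G$ on $A\cup B$; a non-edge $(i,j)$ lies in $G_{A,B}$ if $i\in A$ and $j\in B$. A $G$-partial matrix over $\mathbb{C}$ is a vector $M\in\mathbb{C}^E$; a completion of $M$ is an $m\times n$ complex matrix $A$ with $A_{ij}=M_{ij}$ for all $(i,j)\in E$; the complex completion rank of $M$ is the smallest rank of a completion. The generic completion rank $\operatorname{gcr}(G)$ is the unique integer that is the complex completion rank of all $M$ in some nonempty Zariski-open subset of $\mathbb{C}^E$. *)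

(* Defs.v *)
From mathcomp Require Import all_boot all_order all_algebra.
From mathcomp Require Import boolp classical_sets reals complex.
From mathcomp Require mpoly.

Set Implicit Arguments.
Unset Strict Implicit.
Unset Printing Implicit Defensive.

Import GRing.Theory.

Local Open Scope ring_scope.

(** A bipartite graph with parts [m] and [n] (0-based: ['I_m], ['I_n]) is given
    by its edge set; the two parts are disjoint because edges are ordered pairs. *)
Definition bigraph (m n : nat) := {set 'I_m * 'I_n}.

Definition nonedges m n (E : bigraph m n) : {set 'I_m * 'I_n} := ~: E.

Definition induced_nonedges m n (E : bigraph m n)
    (A : {set 'I_m}) (B : {set 'I_n}) : {set 'I_m * 'I_n} :=
  nonedges E :&: finset.setX A B.

(** The affine space K^T of a finite set T; the k-th variable of a polynomial is
    the coordinate indexed by the k-th element of T. *)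
Definition peval (K : comNzRingType) (T : finType)
    (p : mpoly.mpoly #|T| K) (x : {ffun T -> K}) : K :=
  mpoly.meval (fun k : 'I_#|T| => x (enum_val k)) p.

Definition zariski_closed (K : comNzRingType) (T : finType)
    (Z : set {ffun T -> K}) : Prop :=
  exists S : set (mpoly.mpoly #|T| K),
    forall x, Z x <-> (forall p, S p -> peval p x = 0).

Definition zariski_open (K : comNzRingType) (T : finType)
    (U : set {ffun T -> K}) : Prop :=
  zariski_closed (~` U)%classic.

Section Completion.
Variables (K : fieldType) (m n : nat) (E : bigraph m n).

Definition partial_mx := {ffun {e : 'I_m * 'I_n | e \in E} -> K}.

Definition completion (M : partial_mx) (A : 'M[K]_(m, n)) : Prop :=
  forall e : {e : 'I_m * 'I_n | e \in E}, A (val e).1 (val e).2 = M e.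

Lemma ex_completion_rank (M : partial_mx) :
  exists k : nat, `[< exists2 A, completion M A & \rank A = k >].
Proof.
pose A : 'M[K]_(m, n) := \matrix_(i, j) oapp M 0 (insub (i, j)).
exists (\rank A); apply/asboolP; exists A => // e.
by rewrite mxE -surjective_pairing valK.
Qed.

Definition completion_rank (M : partial_mx) : nat :=
  ex_minn (ex_completion_rank M).

Definition generic_rank_value (k : nat) : Prop :=
  exists U : set partial_mx,
    [/\ zariski_open U, (U !=set0)%classic &
        forall M, U M -> completion_rank M = k].

(** [is_gcr k] reads "gcr(G) = k": k is the unique integer with the property. *)
Definition is_gcr (k : nat) : Prop := unique generic_rank_value k.

End Completion.

(* Main.v *)
Require Import Defs.
From mathcomp Require Import all_boot all_order all_algebra.
From mathcomp Require Import closed_field zify mpoly.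
From mathcomp Require Import reals complex.

(** The graph has as many edges as the variety of matrices of rank at most [r]
    has dimensions, so the claim is that projecting this variety to the
    coordinates in [E] reaches almost every partial matrix, while projecting the
    matrices of smaller rank does not. Here almost every means outside the zero
    set of some nonzero polynomial ([generic]).

    Upper bound. Let the columns of [K^T] be a basis of the vectors whose sum
    over each part of the row partition [P] is zero, and the rows of [K'] a basis
    of the analogous space for the column partition [Q]. Both bases have [r]
    elements because there are [m - r] and [n - r] parts. At the rank [r] matrix
    [K^T *m K'] the tangent space of the variety consists of the matrices
    [K^T *m Y + X *m K'],
    which are exactly the matrices whose sum over each block [A x B] is zero
    ([tangent_decomposition]). Each block contains exactly one non-edge, so any
    values prescribed on [E] extend to such a matrix: the value at the non-edge
    balances its block ([zero_block_sum_extension]). Hence the tangent space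
    projects onto all of [F^E], and the curves [(K^T + c X)(K' + c Y)] leave the
    base point in every direction of [F^E]. A nonzero polynomial cannot vanish
    along such curves in all directions, since its lowest order homogeneous part
    at the base point would vanish ([not_cogeneric_of_curves]). So the set
    of partial matrices with a completion of rank at most [r] is dense. Over an
    algebraically closed field it is definable without quantifiers, and such a
    set either contains or misses a nonempty open set ([image_generic]); being
    dense, it contains one.

    Lower bound. A matrix of rank [k] is a product [X *m Y] in which some [k]
    rows of [X] form the identity, which leaves [k (m + n - k)] parameters. For
    [k < r] this is less than [#|E|], and a polynomial map into a space of larger
    dimension misses a nonempty open set because its components are algebraically
    dependent ([algebraic_dependence], by counting monomials). There are only
    finitely many choices of [k] and of the rows. *)

Set Implicit Arguments.
Unset Strict Implicit.
Unset Printing Implicit Defensive.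

Import GRing.Theory.

(** * Generic properties of points of an affine space *)

Lemma digits_inj D n (a b : 'I_n -> nat) :
  (forall i, a i < D) -> (forall i, b i < D) ->
  \sum_(i < n) a i * D ^ i = \sum_(i < n) b i * D ^ i -> a =1 b.
Proof.
elim: n a b => [|n IHn] a b ltaD ltbD; first by move=> _ [].
have shift c : \sum_(i < n.+1) c i * D ^ i =
    c ord0 + (\sum_(i < n) c (lift ord0 i) * D ^ i) * D.
  rewrite big_ord_recl muln1 big_distrl /=; congr (_ + _).
  by apply: eq_bigr => i _; rewrite -mulnA -expnSr.
rewrite !shift => eq_ab.
have D_gt0 : 0 < D by apply: leq_ltn_trans (ltaD ord0).
have eq0 : a ord0 = b ord0.
  have /(congr1 (modn^~ D)) := eq_ab.
  by rewrite ![(_ + _ * D)%N]addnC !modnMDl !modn_small.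
move/eqP: eq_ab; rewrite eq0 eqn_add2l eqn_pmul2r // => /eqP/IHn eqS i.
case: (unliftP ord0 i) => [j ->|-> //]; exact: eqS.
Qed.

Section Generic.

Local Open Scope ring_scope.

Variable F : closedFieldType.

(** Kronecker substitution: on the points [(t, t^D, t^(D^2), ...)] the monomials
    of [p] become distinct powers of [t], so [p] restricts to a nonzero
    polynomial in one variable. *)
Lemma mpoly_nonvanishing n (p : {mpoly F[n]}) :
  p != 0 -> exists x : 'I_n -> F, p.@[x] != 0.
Proof.
move=> p_neq0; pose D := msize p.
pose w (m : 'X_{1..n}) := (\sum_(i < n) m i * D ^ i)%N.
pose q : {poly F} := \sum_(m <- msupp p) p@_m *: 'X^(w m).
have qE t : q.[t] = p.@[fun i : 'I_n => t ^+ (D ^ i)].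
  rewrite horner_sum mevalE; apply: eq_bigr => m _.
  rewrite hornerZ hornerXn /w expr_sum; congr (_ * _).
  by apply: eq_bigr => i _; rewrite mulnC exprM.
have lt_digit m : m \in msupp p -> forall i, (m i < D)%N.
  move=> /msize_mdeg_lt; rewrite mdegE => lt_m i.
  by apply: leq_ltn_trans lt_m; rewrite (bigD1 i) //= leq_addr.
have q_neq0 : q != 0.
  apply/eqP => /polyP/(_ (w (mlead p))); rewrite coef0 coef_sum.
  rewrite (bigD1_seq (mlead p)) ?msupp_uniq ?mlead_supp //=.
  rewrite coefZ coefXn eqxx mulr1 big_seq_cond big1 ?addr0 => [|m].
    by apply/eqP; rewrite mleadc_eq0.
  case/andP=> supp_m neq_m; rewrite coefZ coefXn.
  case: eqP => [eq_w|]; last by rewrite mulr0.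
  case/eqP: neq_m; apply/mnmP/(@digits_inj D) => //; apply: lt_digit => //.
  exact: mlead_supp.
have [t] := PreClosedField.closed_nonrootP (@GRing.solve_monicpoly F) q q_neq0.
by rewrite rootE qE; exists (fun i : 'I_n => t ^+ (D ^ i)).
Qed.

Definition generic (T : finType) (P : {ffun T -> F} -> Prop) :=
  exists2 p : {mpoly F[#|T|]}, p != 0 & forall x, peval p x != 0 -> P x.

Section GenericTheory.

Variable T : finType.
Implicit Types P Q : {ffun T -> F} -> Prop.

Lemma generic_sub P Q : (forall x, P x -> Q x) -> generic P -> generic Q.
Proof. by move=> PQ [p p0 pP]; exists p => // x /pP/PQ. Qed.

Lemma generic_all P : (forall x, P x) -> generic P.
Proof. by exists 1 => //; apply: oner_neq0. Qed.

Lemma generic_and P Q : generic P -> generic Q -> generic (fun x => P x /\ Q x).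
Proof.
move=> [p p0 pP] [q q0 qQ]; exists (p * q); first by rewrite mulf_neq0.
by move=> x; rewrite /peval mevalM mulf_eq0 => /norP[/pP ? /qQ].
Qed.

Lemma generic_forall (I : finType) (P : I -> {ffun T -> F} -> Prop) :
  (forall i, generic (P i)) -> generic (fun x => forall i, P i x).
Proof.
move=> gP; suff: generic (fun x => forall i, i \in enum I -> P i x).
  by apply: generic_sub => x Px i; apply: Px; rewrite mem_enum.
elim: (enum I) => [|i s IHs]; first exact: generic_all.
have := generic_and (gP i) IHs; apply: generic_sub => x [Pix Psx] j.
by rewrite inE => /predU1P[->|/Psx].
Qed.

Lemma generic_ex P : generic P -> exists x, P x.
Proof.
move=> [p /mpoly_nonvanishing [v pv] pP].
exists [ffun t => v (enum_rank t)]; apply: pP.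
by rewrite /peval (@meval_eq _ _ _ v) // => k; rewrite ffunE enum_valK.
Qed.

(** A nonempty open set contains the complement of the zero set of any nonzero
    polynomial that vanishes outside it, and such a complement is open; it is
    nonempty by [generic_ex]. *)
Lemma generic_openP P :
  generic P <-> exists U : classical_sets.set {ffun T -> F},
    [/\ zariski_open U, classical_sets.nonempty U & forall x, U x -> P x].
Proof.
split=> [gP|[U [[S US] [x Ux] UP]]].
  have [p p0 pP] := gP; exists (fun x => peval p x != 0); split=> //.
    exists (fun q => q = p) => x; rewrite /classical_sets.setC /=; split.
      by move=> px q ->; apply/eqP; apply: contra_notT px.
    by move=> /(_ p erefl) ->; rewrite eqxx.
  by have /generic_ex : generic (fun x => peval p x != 0) by exists p.
have [p Sp px] : exists2 p, S p & peval p x != 0.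
  apply: boolp.contrapT => no_p; apply: (proj2 (US x)) Ux => p Sp.
  by apply: boolp.contrapT => /eqP px; apply: no_p; exists p.
exists p => [|y py]; first by apply: contraNneq px => ->; rewrite /peval meval0.
apply: UP; apply: boolp.contrapT => /US/(_ p Sp)/eqP; exact/negP.
Qed.

End GenericTheory.

End Generic.

(** * Images of polynomial maps over an algebraically closed field *)

Section Chevalley.

Local Open Scope ring_scope.

Variable F : closedFieldType.

(** Here and below the environment [codom x] gives the first [#|T|] variables the
    coordinates of [x] in the order used by [peval], and the others the value 0. *)
Lemma mpoly_of_rterm (T : finType) (t : GRing.term F) : GRing.rterm t ->
  exists p : {mpoly F[#|T|]},
    forall x : {ffun T -> F}, GRing.eval (codom x) t = peval p x.
Proof.
elim: t => //=.
- move=> k _; case: (ltnP k #|T|) => [lt_k|le_k].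
    exists 'X_(Ordinal lt_k) => x; rewrite /peval mevalXU.
    by rewrite -[k]/(nat_of_ord (Ordinal lt_k)) nth_codom.
  by exists 0 => x; rewrite /peval meval0 nth_default ?size_codom.
- by move=> c _; exists c%:MP => x; rewrite /peval mevalC.
- by move=> n _; exists n%:R => x; rewrite /peval rmorph_nat.
- move=> t1 IH1 t2 IH2 /andP[/IH1[p1 p1E] /IH2[p2 p2E]].
  by exists (p1 + p2) => x; rewrite p1E p2E /peval mevalD.
- move=> t1 IH1 /IH1[p1 p1E].
  by exists (- p1) => x; rewrite p1E /peval mevalN.
- move=> t1 IH1 n /IH1[p1 p1E].
  by exists (p1 *+ n) => x; rewrite p1E /peval mevalMn.
- move=> t1 IH1 t2 IH2 /andP[/IH1[p1 p1E] /IH2[p2 p2E]].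
  by exists (p1 * p2) => x; rewrite p1E p2E /peval mevalM.
move=> t1 IH1 n /IH1[p1 p1E].
by exists (p1 ^+ n) => x; rewrite p1E /peval rmorphXn.
Qed.

(** Off the zero sets of the nonzero polynomials [t1 - t2] in the formula, the
    truth value of each atom is constant. *)
Lemma qf_eval_generic (T : finType) (f : GRing.formula F) :
  GRing.qf_form f -> GRing.rformula f ->
  exists b, generic (fun x : {ffun T -> F} => GRing.qf_eval (codom x) f = b).
Proof.
elim: f => //=.
- by move=> b _ _; exists b; apply: generic_all.
- move=> t1 t2 _ /andP[/(mpoly_of_rterm T)[p1 p1E] /(mpoly_of_rterm T)[p2 p2E]].
  case: (eqVneq p1 p2) => [eq_p|neq_p].
    by exists true; apply: generic_all => x; rewrite p1E p2E eq_p eqxx.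
  exists false; exists (p1 - p2) => [|x]; first by rewrite subr_eq0.
  by rewrite /peval mevalB subr_eq0 p1E p2E => /negbTE.
- move=> f1 IH1 f2 IH2 /andP[q1 q2] /andP[r1 r2].
  have [[b1 g1] [b2 g2]] := (IH1 q1 r1, IH2 q2 r2); exists (b1 && b2).
  by apply: generic_sub (generic_and g1 g2) => x [-> ->].
- move=> f1 IH1 f2 IH2 /andP[q1 q2] /andP[r1 r2].
  have [[b1 g1] [b2 g2]] := (IH1 q1 r1, IH2 q2 r2); exists (b1 || b2).
  by apply: generic_sub (generic_and g1 g2) => x [-> ->].
- move=> f1 IH1 f2 IH2 /andP[q1 q2] /andP[r1 r2].
  have [[b1 g1] [b2 g2]] := (IH1 q1 r1, IH2 q2 r2); exists (b1 ==> b2).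
  by apply: generic_sub (generic_and g1 g2) => x [-> ->].
move=> f1 IH1 q1 r1; have [b1 g1] := IH1 q1 r1; exists (~~ b1).
by apply: generic_sub g1 => x ->.
Qed.

(** Quantifier elimination reduces this to [qf_eval_generic]. *)
Lemma definable_generic (T : finType) (f : GRing.formula F) :
  generic (fun x : {ffun T -> F} => GRing.holds (codom x) f) \/
  generic (fun x : {ffun T -> F} => ~ GRing.holds (codom x) f).
Proof.
have elimP e := GRing.quantifier_elim_rformP (@ClosedFieldQE.wf_ex_elim F)
  (ClosedFieldQE.holds_ex_elim (@GRing.solve_monicpoly F)) e
  (GRing.to_rform_rformula f).
have /andP[qf rf] := GRing.quantifier_elim_wf (@ClosedFieldQE.wf_ex_elim F)
  (GRing.to_rform_rformula f).
have [[] gf] := qf_eval_generic T qf rf; [left | right].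
  by apply: generic_sub gf => x /elimP/GRing.to_rformP.
by apply: generic_sub gf => x fx /GRing.to_rformP/elimP; rewrite fx.
Qed.

(** The offset [d] leaves room for variables that come before those of [p]. *)
Lemma term_of_mpoly d n (p : {mpoly F[n]}) :
  exists t : GRing.term F,
    forall e, GRing.eval e t = p.@[fun k : 'I_n => e`_(d + k)].
Proof.
elim/mpolyind: p => [|c m p _ _ [t tE]].
  by exists (GRing.Const 0) => e; rewrite meval0.
pose mon := \big[GRing.Mul/GRing.Const 1]_(i < n)
  GRing.Exp (GRing.Var F (d + i)) (m i).
exists (GRing.Add (GRing.Mul (GRing.Const c) mon) t) => e /=.
rewrite tE mevalD mevalZ mevalX /mon.
by rewrite (big_morph (GRing.eval e) (id1 := 1) (op1 := *%R)).
Qed.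

(** Weak form of Chevalley's theorem on constructible sets: the image is defined
    by an existential formula whose free variables, numbered below [#|T|], are
    the coordinates of the target and whose bound variables follow them. *)
Lemma image_generic (S T : finType) (phi : T -> {mpoly F[#|S|]}) :
  let image (y : {ffun T -> F}) := exists x, forall t, y t = peval (phi t) x in
  generic image \/ generic (fun y => ~ image y).
Proof.
move=> image; have [tm tmE] := boolp.choice (fun t => term_of_mpoly #|T| (phi t)).
pose eqn t := GRing.Equal (GRing.Var F (enum_rank t)) (tm t).
pose sys := foldr GRing.And (GRing.Bool true) (map eqn (enum T)).
have sysP e : GRing.holds e sys <->
    forall t, e`_(enum_rank t) = (phi t).@[fun k => e`_(#|T| + k)].
  suff: GRing.holds e sys <-> forall t, t \in enum T ->
      e`_(enum_rank t) = (phi t).@[fun k => e`_(#|T| + k)].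
    by move=> [h1 h2]; split=> [/h1 h t|h]; [apply: h; rewrite mem_enum|apply: h2].
  rewrite /sys; elim: (enum T) => [|t s IHs] //=.
  rewrite tmE; split=> [[et /IHs es] u|es].
    by rewrite inE => /predU1P[->|/es].
  split; first by apply: es; rewrite mem_head.
  by apply/IHs => u us; apply: es; rewrite inE us orbT.
pose f := foldr GRing.Exists sys (iota #|T| #|S|).
have fP (y : {ffun T -> F}) : GRing.holds (codom y) f <-> image y.
  split=> [/GRing.foldExistsP[e eq_e /sysP e_sol]|[x xy]].
    exists [ffun s => e`_(#|T| + enum_rank s)] => t.
    rewrite -[t in LHS]enum_rankK -(nth_codom 0 y) (eq_e (enum_rank t)).
      rewrite e_sol; apply: meval_eq => k.
      by rewrite ffunE enum_valK.
    by rewrite inE mem_iota leqNgt ltn_ord.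
  apply/GRing.foldExistsP; exists (codom y ++ codom x).
    move=> k; rewrite inE mem_iota negb_and -ltnNge -leqNgt => k_out.
    rewrite nth_cat size_codom; case: ltnP k_out => //= le_k k_out.
    by rewrite !nth_default ?size_codom // leq_subRL.
  apply/sysP => t; rewrite nth_cat size_codom ltn_ord nth_codom enum_rankK xy.
  apply: meval_eq => k.
  by rewrite nth_cat size_codom ltnNge leq_addr /= addKn nth_codom.
case: (definable_generic T f) => gf; [left | right];
  by apply: generic_sub gf => y /fP.
Qed.

End Chevalley.

(** * Polynomials along curves *)

Section Curves.

Local Open Scope ring_scope.

Variable F : closedFieldType.

Lemma exists_nonroot_neq0 (q : {poly F}) : q != 0 -> exists2 c, c != 0 & q.[c] != 0.
Proof.
move=> q0; have Xq0 : 'X * q != 0 by rewrite mulf_neq0 ?polyX_eq0.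
have [c] := PreClosedField.closed_nonrootP (@GRing.solve_monicpoly F) _ Xq0.
by rewrite rootE hornerM hornerX mulf_eq0 => /norP[]; exists c.
Qed.

(** Take [w] where the homogeneous part of [q] of least degree [d] does not
    vanish. Along the curve [q] is then [c ^+ d] times a polynomial in [c] whose
    value at 0 is that part evaluated at [w]: the second order terms [G] only
    contribute higher powers of [c]. *)
Lemma mpoly_nonzero_on_curve n (q : {mpoly F[n]}) : q != 0 ->
  exists w : 'I_n -> F, forall G : 'I_n -> {poly F},
    exists c, q.@[fun i => c * w i + c ^+ 2 * (G i).[c]] != 0.
Proof.
move=> q0; pose d := mdeg (mlast q).
have d_le m : m \in msupp q -> (d <= mdeg m)%N.
  by move=> /mlast_lemc/lemc_mdeg.
pose h := \sum_(m <- msupp q | mdeg m == d) q@_m *: 'X_[m].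
have h0 : h != 0.
  apply/eqP => /mpolyP/(_ (mlast q)); rewrite mcoeff0 raddf_sum /=.
  rewrite big_mkcond (bigD1_seq (mlast q)) ?msupp_uniq ?mlast_supp //= eqxx.
  rewrite mcoeffZ mcoeffX eqxx mulr1 big1 ?addr0 => [|m /negbTE neq_m].
    by move/eqP; apply/negP; rewrite -mcoeff_msupp mlast_supp.
  by case: ifP; rewrite // mcoeffZ mcoeffX neq_m mulr0.
have [w hw] := mpoly_nonvanishing h0; exists w => G.
(* The restriction of q to the curve, divided by c ^+ d *)
pose r := \sum_(m <- msupp q)
  q@_m *: ('X^(mdeg m - d) * \prod_i ((w i)%:P + 'X * G i) ^+ m i).
have r0 : r != 0.
  apply: contraNneq hw => r_eq0.
  have <- : r.[0] = h.@[w]; last by rewrite r_eq0 horner0.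
  rewrite horner_sum raddf_sum /= [RHS]big_mkcond /= big_seq [RHS]big_seq.
  apply: eq_bigr => m /d_le le_dm.
  rewrite hornerZ hornerM hornerXn expr0n subn_eq0 eqn_leq le_dm andbT.
  case: ifP => _; last by rewrite mul0r mulr0.
  rewrite mul1r mevalZ mevalX horner_prod; congr (_ * _); apply: eq_bigr => i _.
  by rewrite horner_exp hornerD hornerC hornerM hornerX mul0r addr0.
have [c c0 rc] := exists_nonroot_neq0 r0; exists c.
suff -> : q.@[fun i => c * w i + c ^+ 2 * (G i).[c]] = c ^+ d * r.[c].
  by rewrite mulf_neq0 ?expf_neq0.
rewrite mevalE horner_sum mulr_sumr big_seq [RHS]big_seq.
apply: eq_bigr => m /d_le le_dm.
rewrite hornerZ mulrCA hornerM hornerXn; congr (_ * _).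
rewrite mulrA -exprD subnKC // horner_prod mdegE expr_sum -big_split /=.
apply: eq_bigr => i _; rewrite horner_exp -exprMn; congr (_ ^+ _).
by rewrite hornerD hornerC hornerM hornerX mulrDr mulrA.
Qed.

(** An elementary form of the fact that a map with surjective differential at one
    point is dominant: first order information at [M0] gives density of [P]. *)
Lemma not_cogeneric_of_curves (T : finType) (P : {ffun T -> F} -> Prop)
    (M0 : {ffun T -> F}) :
  (forall w : {ffun T -> F}, exists G : T -> {poly F},
     forall c, P [ffun t => M0 t + c * w t + c ^+ 2 * (G t).[c]]) ->
  ~ generic (fun x => ~ P x).
Proof.
move=> curves [p p0 pP].
pose q := p \mPo [tuple 'X_i + (M0 (enum_val i))%:MP | i < #|T|].
have qE v : q.@[v] = p.@[fun i => v i + M0 (enum_val i)].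
  rewrite comp_mpoly_meval; apply: meval_eq => i.
  by rewrite tnth_mktuple mevalD mevalXU mevalC.
have q0 : q != 0.
  have [v pv] := mpoly_nonvanishing p0; apply: contraNneq pv => q_eq0.
  have := qE (fun i => v i - M0 (enum_val i)).
  by rewrite q_eq0 meval0 => ->; apply/eqP/meval_eq => i; rewrite subrK.
have [w curve] := mpoly_nonzero_on_curve q0.
have [G PG] := curves [ffun t => w (enum_rank t)].
have [c] := curve (fun i => G (enum_val i)).
rewrite qE => pc; apply: pP (PG c); apply: contraNneq pc => <-.
by apply/eqP/meval_eq => i; rewrite !ffunE enum_valK addrC addrA.
Qed.

End Curves.

(** * Algebraic dependence *)

Section Dependence.

Local Open Scope ring_scope.

Definition mdeg_le (R : nzRingType) n (p : {mpoly R[n]}) k :=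
  forall m, m \in msupp p -> (mdeg m <= k)%N.

Lemma mdeg_le1 (R : nzRingType) n : mdeg_le (1 : {mpoly R[n]}) 0.
Proof. by move=> m; rewrite msupp1 inE => /eqP->; rewrite mdeg0. Qed.

Lemma mdeg_leM (R : nzRingType) n (p q : {mpoly R[n]}) k l :
  mdeg_le p k -> mdeg_le q l -> mdeg_le (p * q) (k + l).
Proof.
move=> pk ql m /msuppM_le/allpairsP[[m1 m2] /= [/pk le1 /ql le2 ->]].
by rewrite mdegD leq_add.
Qed.

Lemma mdeg_leX (R : nzRingType) n (p : {mpoly R[n]}) k l :
  mdeg_le p k -> mdeg_le (p ^+ l) (l * k).
Proof.
move=> pk; elim: l => [|l IHl]; first exact: mdeg_le1.
by rewrite exprS mulSn; apply: mdeg_leM.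
Qed.

(** The [D ^ d] products of powers [phi i ^+ a i] with [a i < D] lie in the span
    of the monomials with exponents below [B = c * d * D], of which there are
    [(c * d) ^ s * D ^ s]. With [D] above [(c * d) ^ s] the products outnumber
    the monomials, so they satisfy a linear relation. *)
Lemma algebraic_dependence (F : fieldType) d s (phi : 'I_d -> {mpoly F[s]}) :
  (s < d)%N -> exists2 p : {mpoly F[d]}, p != 0 & p \mPo [tuple phi i | i < d] = 0.
Proof.
move=> lt_sd; pose c := (\max_i msize (phi i)).+1.
pose D := ((c * d) ^ s).+1; pose B := (c * d * D)%N.
have d_gt0 : (0 < d)%N by apply: leq_ltn_trans lt_sd.
have cd_gt0 : (0 < c * d)%N by rewrite muln_gt0.
have phi_c i : mdeg_le (phi i) c.
  move=> m /msize_mdeg_lt lt_m; apply: ltnW; apply: leq_trans lt_m _.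
  by rewrite ltnW // ltnS (leq_bigmax i).
pose mon (a : {ffun 'I_d -> 'I_D}) := [multinom (a i : nat) | i < d].
have mon_inj : injective mon.
  move=> a a' /mnmP eq_aa'; apply/ffunP => i; apply: val_inj.
  by have := eq_aa' i; rewrite !mnmE.
pose prodphi (a : {ffun 'I_d -> 'I_D}) := \prod_i phi i ^+ mon a i.
have exp_lt a m : m \in msupp (prodphi a) -> forall i, (m i < B)%N.
  move=> supp_m i; apply: leq_ltn_trans (_ : mdeg m < B)%N.
    by rewrite mdegE (bigD1 i) //= leq_addr.
  have deg_prod : mdeg_le (prodphi a) (\sum_(i < d) mon a i * c).
    rewrite /prodphi; apply: (big_ind2 (@mdeg_le F s)) => [|p k q l|k _].
    - exact: mdeg_le1.
    - exact: mdeg_leM.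
    - exact: mdeg_leX.
  apply: leq_ltn_trans (deg_prod m supp_m) _.
  apply: leq_ltn_trans (_ : \sum_(i < d) D.-1 * c < B)%N.
    by apply: leq_sum => k _; rewrite leq_mul2r mnmE -ltnS ltn_ord orbT.
  rewrite sum_nat_const card_ord /B mulnC -mulnA [X in (_ < X)%N]mulnC.
  by rewrite ltn_pmul2r.
pose col (b : {ffun 'I_s -> 'I_B}) := [multinom (b i : nat) | i < s].
pose A := \matrix_(a < #|{ffun 'I_d -> 'I_D}|, b < #|{ffun 'I_s -> 'I_B}|)
  (prodphi (enum_val a))@_(col (enum_val b)).
have [v vA v0] : exists2 v : 'rV_#|{ffun 'I_d -> 'I_D}|, v *m A = 0 & v != 0.
  have /rowV0Pn[v /sub_kermxP] : kermx A != 0; last by exists v.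
  rewrite kermx_eq0 /row_free neq_ltn (leq_ltn_trans (rank_leq_col A)) //.
  rewrite !card_ffun !card_ord expnMn.
  apply: leq_trans (_ : D ^ s.+1 <= _)%N.
    by rewrite expnS ltn_pmul2r ?expn_gt0 // ltnSn.
  by rewrite leq_exp2l // ltnS expn_gt0 cd_gt0.
exists (\sum_a v 0 a *: 'X_[mon (enum_val a)]).
  apply: contraNneq v0 => p_eq0; apply/eqP/rowP => a; rewrite mxE.
  have := congr1 (mcoeff (mon (enum_val a))) p_eq0.
  rewrite mcoeff0 raddf_sum /= (bigD1 a) //= mcoeffZ mcoeffX eqxx mulr1.
  rewrite big1 ?addr0 // => a' neq_a; rewrite mcoeffZ mcoeffX.
  by rewrite (inj_eq mon_inj) (inj_eq enum_val_inj) (negbTE neq_a) mulr0.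
rewrite raddf_sum /=.
rewrite (eq_bigr (fun a => v 0 a *: prodphi (enum_val a))) => [|a _]; last first.
  rewrite comp_mpolyZ comp_mpolyX; congr (_ *: _); apply: eq_bigr => i _.
  by rewrite tnth_mktuple.
apply/mpolyP => m; rewrite mcoeff0 raddf_sum /=.
(* Monomials outside the box are not columns of A, but they occur in no product. *)
have [lt_mB|] := boolP [forall i, m i < B]%N.
  pose b : {ffun 'I_s -> 'I_B} := [ffun i => Ordinal (forallP lt_mB i)].
  have -> : m = col b by apply/mnmP => i; rewrite mnmE ffunE.
  have := congr1 (fun u : 'rV_#|{ffun 'I_s -> 'I_B}| => u 0 (enum_rank b)) vA.
  rewrite !mxE => vAb; rewrite -[RHS]vAb; apply: eq_bigr => a _.
  by rewrite mcoeffZ mxE enum_rankK.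
rewrite negb_forall => /existsP[i le_Bm]; apply: big1 => a _.
rewrite mcoeffZ memN_msupp_eq0 ?mulr0 //; apply: contra le_Bm => /exp_lt; exact.
Qed.

Lemma image_cogeneric (F : closedFieldType) (S T : finType)
    (phi : T -> {mpoly F[#|S|]}) : (#|S| < #|T|)%N ->
  generic (fun y : {ffun T -> F} => ~ exists x, forall t, y t = peval (phi t) x).
Proof.
move=> /(algebraic_dependence (fun k => phi (enum_val k)))[p p0 p_phi].
exists p => // y py [x xy]; case/negP: py.
have := congr1 (meval (fun k => x (enum_val k))) p_phi.
rewrite meval0 comp_mpoly_meval => <-; apply/eqP/meval_eq => k.
by rewrite tnth_mktuple xy.
Qed.

End Dependence.

(** * Matrices with zero block sums *)

Section Blocks.

Local Open Scope ring_scope.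

Variable F : fieldType.

Definition incidence m (P : {set {set 'I_m}}) : 'M[F]_(m, #|P|) :=
  \matrix_(i < m, a < #|P|) (i \in (enum_val a : {set 'I_m}))%:R.

(** The retraction selects a representative of each part. *)
Lemma incidence_retraction m (P : {set {set 'I_m}}) : partition P setT ->
  exists T : 'M[F]_(#|P|, m), T *m incidence P = 1%:M.
Proof.
case/and3P=> _ trivP P0.
have /boolp.choice[rep repP] (a : 'I_#|P|) : exists i, i \in (enum_val a : {set 'I_m}).
  by apply/set0Pn; apply: contraNneq P0 => <-; apply: enum_valP.
exists (\matrix_(a, i) (i == rep a)%:R); apply/matrixP => a b; rewrite !mxE.
rewrite (bigD1 (rep a)) //= !mxE eqxx mul1r big1 ?addr0 => [|i /negbTE neq_i].
  congr ((nat_of_bool _)%:R); apply/idP/eqP => [rep_b|<- //]; apply: enum_val_inj.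
  rewrite -(def_pblock trivP (enum_valP a) (repP a)).
  exact: def_pblock (enum_valP b) rep_b.
by rewrite mxE neq_i mul0r.
Qed.

Lemma incidence_block_sum m n (P : {set {set 'I_m}}) (Q : {set {set 'I_n}})
    (W : 'M[F]_(m, n)) a b :
  ((incidence P)^T *m W *m incidence Q) a b =
  \sum_(e in finset.setX (enum_val a) (enum_val b)) W e.1 e.2.
Proof.
transitivity (\sum_(i in enum_val a) \sum_(j in enum_val b) W i j); last first.
  by rewrite pair_big; apply: eq_bigl => -[i j]; rewrite finset.in_setX.
rewrite exchange_big [RHS]big_mkcond mxE; apply: eq_bigr => j _ /=.
rewrite !mxE; case: (j \in _); last by rewrite mulr0.
rewrite mulr1 [RHS]big_mkcond; apply: eq_bigr => i _.
by rewrite !mxE; case: (i \in _); rewrite (mul0r, mul1r).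
Qed.

Lemma row_kernel_basis m p r (S : 'M[F]_(m, p)) (T : 'M_(p, m)) :
  T *m S = 1%:M -> (r = m - p)%N -> exists K : 'M_(r, m), (K :=: kermx S)%MS.
Proof.
move=> TS ->; have <- : \rank (kermx S) = (m - p)%N.
  rewrite mxrank_ker; congr (_ - _)%N.
  by apply/eqP; rewrite -[_ == _]/(row_full S); apply/row_fullP; exists T.
by exists (row_base (kermx S)); apply: eq_row_base.
Qed.

(** [W2], which collects the sums of [S^T *m W] in the rows selected by [T], has
    the same image under [S^T] as [W] and is killed by [S'] on the right. Thus
    [W2] factors through [K'], and [W - W2] through [K]. *)
Lemma tangent_decomposition m n p q r (S : 'M[F]_(m, p)) (T : 'M_(p, m))
    (S' : 'M_(n, q)) (K : 'M_(r, m)) (K' : 'M_(r, n)) (W : 'M_(m, n)) :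
  T *m S = 1%:M -> (K :=: kermx S)%MS -> (K' :=: kermx S')%MS ->
  S^T *m W *m S' = 0 ->
  exists (X : 'M_(m, r)) (Y : 'M_(r, n)), W = K^T *m Y + X *m K'.
Proof.
move=> TS defK defK' SWS'; pose W2 := T^T *m (S^T *m W).
have /submxP[X W2E] : (W2 <= K')%MS.
  by rewrite defK'; apply/sub_kermxP; rewrite -mulmxA SWS' mulmx0.
have /submxP[Y W1E] : ((W - W2)^T <= K)%MS.
  rewrite defK; apply/sub_kermxP/trmx_inj.
  by rewrite trmx0 trmx_mul trmxK mulmxBr mulmxA -trmx_mul TS trmx1 mul1mx subrr.
exists X, Y^T; rewrite -W2E -trmx_mul -W1E trmxK addrC subrKC //.
Qed.

(** The value at the unique non-edge of a block is free to cancel the sum of the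
    prescribed values in that block. *)
Lemma zero_block_sum_extension m n (E : bigraph m n) (P : {set {set 'I_m}})
    (Q : {set {set 'I_n}}) (w : 'M[F]_(m, n)) :
  partition P setT -> partition Q setT ->
  (forall A B, A \in P -> B \in Q -> #|induced_nonedges E A B| = 1%N) ->
  exists2 W : 'M[F]_(m, n), (forall i j, (i, j) \in E -> W i j = w i j) &
    (incidence P)^T *m W *m incidence Q = 0.
Proof.
case/and3P=> _ trivP _ /and3P[_ trivQ _] oneE.
pose W := \matrix_(i, j) (if (i, j) \in E then w i j else
  - \sum_(e in finset.setX (pblock P i) (pblock Q j) :&: E) w e.1 e.2).
exists W => [i j Eij|]; first by rewrite mxE Eij.
apply/matrixP => a b; rewrite incidence_block_sum mxE.
have [PA QB] := (enum_valP a, enum_valP b).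
set A := enum_val a in PA *; set B := enum_val b in QB *.
have /eqP/cards1P[e0 nonE] := oneE A B PA QB.
rewrite (big_setID E) /=.
have -> : finset.setX A B :\: E = [set e0].
  by rewrite -nonE /induced_nonedges /nonedges finset.setDE finset.setIC.
have /setIP[] : e0 \in induced_nonedges E A B by rewrite nonE set11.
rewrite big_set1 inE; case: e0 {nonE} => i j notE /setXP[/= Ai Bj].
rewrite mxE (negbTE notE) (def_pblock trivP PA Ai) (def_pblock trivQ QB Bj).
apply/eqP; rewrite subr_eq0; apply/eqP/eq_bigr => -[i' j'] /setIP[_ Ee].
by rewrite mxE Ee.
Qed.

End Blocks.

(** * Generic completion rank *)

Section GenericRank.

Local Open Scope ring_scope.

Variables (F : closedFieldType) (m n : nat) (E : bigraph m n).

Lemma peval_mulmx (S : finType) k (X : 'M[{mpoly F[#|S|]}]_(m, k))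
    (Y : 'M_(k, n)) (x : {ffun S -> F}) i j :
  peval ((X *m Y) i j) x =
  (map_mx (fun p => peval p x) X *m map_mx (fun p => peval p x) Y) i j.
Proof.
rewrite !mxE /peval raddf_sum; apply: eq_bigr => l _.
by rewrite /= mevalM !mxE.
Qed.

(** A factored form of completability in rank at most [r], which makes the set
    the image of a polynomial map. *)
Definition factor_completable r (M : partial_mx F E) :=
  exists (X : 'M_(m, r)) (Y : 'M_(r, n)), completion M (X *m Y).

Lemma factor_completable_generic r :
  generic (factor_completable r) \/ generic (fun M => ~ factor_completable r M).
Proof.
pose S : finType := ('I_m * 'I_r + 'I_r * 'I_n)%type.
pose Xp : 'M[{mpoly F[#|S|]}]_(m, r) :=
  \matrix_(i, k) 'X_(enum_rank (inl (i, k) : S)).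
pose Yp : 'M[{mpoly F[#|S|]}]_(r, n) :=
  \matrix_(k, j) 'X_(enum_rank (inr (k, j) : S)).
pose phi (e : {e | e \in E}) := (Xp *m Yp) (val e).1 (val e).2.
have imP (M : partial_mx F E) :
    (exists x, forall e, M e = peval (phi e) x) <-> factor_completable r M.
  split=> [[x Mx]|[X [Y MXY]]].
    exists (map_mx (fun p => peval p x) Xp), (map_mx (fun p => peval p x) Yp) => e.
    by rewrite Mx peval_mulmx.
  exists [ffun s : S => match s with inl u => X u.1 u.2 | inr u => Y u.1 u.2 end].
  move=> e; rewrite -MXY peval_mulmx; congr ((_ *m _) _ _);
    by apply/matrixP => i j; rewrite !mxE /peval mevalXU enum_rankK ffunE.
have [gM|gM] := image_generic phi; [left | right];
  by apply: generic_sub gM => M /imP.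
Qed.

(** The hypothesis says that the tangent space at [K^T *m K'] projects onto all
    of [F^E]. The curve in the direction [w] is [(K^T + c X)(K' + c Y)], whose
    second order term is [X *m Y]. *)
Lemma generic_factor_completable r (K : 'M[F]_(r, m)) (K' : 'M_(r, n)) :
  (forall w : 'M[F]_(m, n), exists (X : 'M_(m, r)) (Y : 'M_(r, n)),
     forall i j, (i, j) \in E -> (K^T *m Y + X *m K') i j = w i j) ->
  generic (factor_completable r).
Proof.
move=> tangent; case: (factor_completable_generic r) => // cog; exfalso.
pose M0 : partial_mx F E := [ffun e => (K^T *m K') (val e).1 (val e).2].
move: cog; apply: (not_cogeneric_of_curves (M0 := M0)) => w.
have [X [Y XYw]] := tangent (\matrix_(i, j) oapp w 0 (insub (i, j))).
exists (fun e => ((X *m Y) (val e).1 (val e).2)%:P) => c.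
exists (K^T + c *: X), (K' + c *: Y) => e; rewrite !ffunE hornerC.
have := XYw (val e).1 (val e).2; rewrite -surjective_pairing => /(_ (valP e)).
rewrite [in X in _ = X]mxE -surjective_pairing valK /= => <-.
rewrite mulmxDl !mulmxDr -!scalemxAl -!scalemxAr scalerA -expr2.
by rewrite !mxE mulrDr !addrA.
Qed.

(** Express all rows of [A] in a basis chosen among them. Normalizing [X] removes
    the [k ^ 2] redundant parameters of a factorization of rank [k]. *)
Lemma normalized_factorization (A : 'M[F]_(m, n)) :
  exists2 f : 'I_(\rank A) -> 'I_m, injective f &
    exists (X : 'M_(m, \rank A)) (Y : 'M_(\rank A, n)),
      rowsub f X = 1%:M /\ A = X *m Y.
Proof.
exists (maxrankfun A); first exact: maxrankfun_inj.
have /submxP[X AX] : (A <= rowsub (maxrankfun A) A)%MS by rewrite eq_maxrowsub.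
exists X, (rowsub (maxrankfun A) A); split=> //.
apply: (row_free_inj (maxrowsub_free A)).
by rewrite /= mul1mx mul_rowsub_mx -AX.
Qed.

(** The free parameters are the rows of [X] outside the image of [f] and all of
    [Y], in total [(m - k) * k + k * n]. *)
Lemma normalized_cogeneric k (f : 'I_k -> 'I_m) :
  injective f -> (k * (m + n - k) < #|E|)%N ->
  generic (fun M : partial_mx F E => ~ exists (X : 'M_(m, k)) (Y : 'M_(k, n)),
    rowsub f X = 1%:M /\ completion M (X *m Y)).
Proof.
move=> f_inj ltE.
pose S : finType := ({i | i \notin codom f} * 'I_k + 'I_k * 'I_n)%type.
pose Xp : 'M[{mpoly F[#|S|]}]_(m, k) := \matrix_(i, l)
  oapp (fun u => 'X_(enum_rank (inl (u, l) : S))) (f l == i)%:R (insub i).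
pose Yp : 'M[{mpoly F[#|S|]}]_(k, n) :=
  \matrix_(l, j) 'X_(enum_rank (inr (l, j) : S)).
pose phi (e : {e | e \in E}) := (Xp *m Yp) (val e).1 (val e).2.
have ltST : (#|S| < #|{: {e | e \in E}}|)%N.
  rewrite card_sum !card_prod !card_ord card_sig card_sig.
  have -> : #|[pred i | i \notin codom f]| = (m - k)%N.
    have := cardC (mem (codom f)); rewrite card_codom // !card_ord => card_m.
    by rewrite -[X in (X - k)%N]card_m addKn; apply: eq_card.
  have le_km : (k <= m)%N by have := leq_card f f_inj; rewrite !card_ord.
  apply: leq_trans ltE; rewrite ltnS mulnC -mulnDr leq_mul2l addnBAC //.
  by rewrite leqnn orbT.
apply: generic_sub (image_cogeneric phi ltST) => M no_x [X [Y [fX MXY]]].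
apply: no_x; exists [ffun s : S =>
  match s with inl u => X (val u.1) u.2 | inr u => Y u.1 u.2 end].
move=> e; rewrite -MXY peval_mulmx; congr ((_ *m _) _ _); last first.
  by apply/matrixP => i j; rewrite !mxE /peval mevalXU enum_rankK ffunE.
apply/matrixP => i l; rewrite !mxE; case: insubP => [u _ <- /=|].
  by rewrite /peval mevalXU enum_rankK ffunE.
rewrite negbK => /codomP[l' ->]; rewrite /peval rmorph_nat.
by have /matrixP/(_ l' l) := fX; rewrite !mxE (inj_eq f_inj) eq_sym.
Qed.

Lemma generic_rank_lower_bound r :
  (forall k, (k < r)%N -> (k * (m + n - k) < #|E|)%N) ->
  generic (fun M : partial_mx F E => forall A, completion M A -> (r <= \rank A)%N).
Proof.
move=> ltE; pose I : finType := {k : 'I_r & {ffun 'I_k -> 'I_m}}.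
pose bad (u : I) (M : partial_mx F E) := injective (tagged u) ->
  ~ exists (X : 'M_(m, tag u)) (Y : 'M_(tag u, n)),
      rowsub (tagged u) X = 1%:M /\ completion M (X *m Y).
have : generic (fun M => forall u, bad u M).
  apply: generic_forall => u.
  have [f_inj|f_inj] := boolp.pselect (injective (tagged u)); last first.
    by apply: generic_all => M /f_inj.
  apply: generic_sub (normalized_cogeneric f_inj (ltE _ (ltn_ord _))).
  by move=> M noM _.
apply: generic_sub => M badM A MA; rewrite leqNgt; apply/negP => lt_r.
have [f f_inj [X [Y [fX AXY]]]] := normalized_factorization A.
pose u : I := Tagged (fun k : 'I_r => {ffun 'I_k -> 'I_m})
  (finfun f : {ffun 'I_(Ordinal lt_r) -> 'I_m}).
apply: (badM u) => [i j|]; first by rewrite !ffunE => /f_inj.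
exists X, Y; split; last by rewrite -AXY.
by rewrite -fX; apply/matrixP => i j; rewrite !mxE ffunE.
Qed.

Lemma is_gcr_of_generic r :
  generic (fun M : partial_mx F E => completion_rank M = r) -> is_gcr F E r.
Proof.
move=> gr; split; first exact/generic_openP.
move=> k /generic_openP gk.
by have [M [<- <-]] := generic_ex (generic_and gr gk).
Qed.

(** With [r = k + d + 1], [m = r + a] and [n = r + b], the dimension gap
    [r (m + n - r) - k (m + n - k)] equals [(d + 1) (a + b + d + 1) > 0]. *)
Lemma is_gcr_of_tangent r (K : 'M[F]_(r, m)) (K' : 'M_(r, n)) :
  (r <= m)%N -> (r <= n)%N -> #|E| = (r * (m + n - r))%N ->
  (forall w : 'M[F]_(m, n), exists (X : 'M_(m, r)) (Y : 'M_(r, n)),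
     forall i j, (i, j) \in E -> (K^T *m Y + X *m K') i j = w i j) ->
  is_gcr F E r.
Proof.
move=> le_rm le_rn cardE /generic_factor_completable upper.
apply: is_gcr_of_generic.
have /generic_rank_lower_bound lower k : (k < r)%N -> (k * (m + n - k) < #|E|)%N.
  move=> lt_kr; rewrite cardE.
  have [d rE] : exists d, r = (k + d.+1)%N.
    by exists (r - k.+1)%N; rewrite addnS -addSn subnKC.
  have [a mE] : exists a, m = (r + a)%N by exists (m - r)%N; rewrite subnKC.
  have [b nE] : exists b, n = (r + b)%N by exists (n - r)%N; rewrite subnKC.
  have -> : (m + n - k = r + a + b + d.+1)%N by rewrite mE nE {2}rE; lia.
  have -> : (m + n - r = r + a + b)%N by rewrite mE nE; lia.
  rewrite rE; nia.
apply: generic_sub (generic_and upper lower) => M [[X [Y MXY]] rank_ge].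
rewrite /completion_rank; case: ex_minnP => k /boolp.asboolP[A MA <-] minA.
apply/eqP; rewrite eqn_leq rank_ge // andbT.
apply: leq_trans (mulmx_max_rank X Y); apply: minA; apply/boolp.asboolP.
by exists (X *m Y).
Qed.

End GenericRank.

Theorem lemma4p13 (R : realType) (m n r : nat) (E : bigraph m n)
    (hm : 1 <= m) (hn : 1 <= n) (hrm : r <= m) (hrn : r <= n)
    (hE : #|E| = r * (m + n - r))
    (hPQ : exists (P : {set {set 'I_m}}) (Q : {set {set 'I_n}}),
      [/\ partition P [set: 'I_m] /\ #|P| = m - r,
          partition Q [set: 'I_n] /\ #|Q| = n - r,
          forall A B, A \in P -> B \in Q -> #|induced_nonedges E A B| = 1
        & forall e, e \in nonedges E ->
            exists A B, [/\ A \in P, B \in Q & e \in induced_nonedges E A B]]) :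
  is_gcr R[i] E r.
Proof.
case: hPQ => P [Q [[partP cardP] [partQ cardQ] oneE _]].
have [T TP] := incidence_retraction R[i] partP.
have [T' TQ] := incidence_retraction R[i] partQ.
have [|K defK] := row_kernel_basis (r := r) TP; first by rewrite cardP subKn.
have [|K' defK'] := row_kernel_basis (r := r) TQ; first by rewrite cardQ subKn.
apply: (is_gcr_of_tangent (K := K) (K' := K')) => // w.
have [W wW W0] := zero_block_sum_extension w partP partQ oneE.
have [X [Y WE]] := tangent_decomposition TP defK defK' W0.
by exists X, Y => i j Eij; rewrite -WE wW.
Qed.
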